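(* Forcing with $\mathfrak{T}_{\mathcal{V}}/\mathrm{Fin}$ adds a Cohen real.
   Context: Natural numbers are identified with the sets of their predecessors, $n=\{0,\dots,n-1\}$; in particular $2^n=\{0,\dots,2^n-1\}$. For $S\subseteq\omega\times\omega$ put $S(n)=\{m:(n,m)\in S\}$. Let $\mathcal{S}=\{S\subseteq\omega\times\omega: |S(n)|<2^n \text{ for all } n\}$ (the set of slaloms). Let $\mathcal{V}$ be the set of all $S\in\mathcal{S}$ such that $S(n)\subseteq 2^n$ for each $n$ and $\lim_n \frac{1}{2^n}|S(n)|=0$. Let $\Omega=\{(S,n): n\in\omega,\ S\in\mathcal{S},\ S\subseteq n\times 2^n\}$. For $A\subseteq\omega\times\omega$ let $T_A=\{(T,n)\in\Omega: A\cap(n\times 2^n)\subseteq T\}$. For $(S,n)\in\Omega$ let $T_{(S,n)}=\{(T,m)\in\Omega: m\geq n,\ T\cap(n\times 2^n)=S\}$. $\mathfrak{T}_{\mathcal{V}}$ is the subalgebra of $\mathcal{P}(\Omega)$ generated by $\{T_A: A\in\mathcal{V}\}\cup\{T_{(S,n)}:(S,n)\in\Omega\}$, and $\mathfrak{T}_{\mathcal{V}}/\mathrm{Fin}$ is its quotient by the ideal of its finite members. Forcing with a Boolean algebra means forcing with the poset of its nonzero elements ordered by the Boolean order. *)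

(* Defs.v *)
From HB Require Import structures.
From mathcomp Require Import all_boot all_order all_algebra.
From mathcomp Require Import finmap generic_quotient.
From mathcomp Require Import all_classical all_reals all_analysis.

Set Implicit Arguments.
Unset Strict Implicit.
Unset Printing Implicit Defensive.

Import Order.TTheory GRing.Theory Num.Theory.
Import numFieldNormedType.Exports.

Local Open Scope order_scope.
Local Open Scope quotient_scope.
Local Open Scope classical_set_scope.

(*  Forcing is rendered inside the ground model.  A real of the extension is a
    subset of omega, and every such subset is the value of a name whose
    elements are pairs (check n, p); such a name is given here as a set of
    pairs (n, p), with no antichain condition. *)

Section Forcing.
Context {d : Order.disp_t} {P : porderType d}.
Implicit Types (p q r : P) (c : set (nat * P)).

Definition dense_below p (D : set P) :=
  forall q, q <= p -> exists2 r, r <= q & D r.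

(* p ||- check n \in c *)
Definition forces_in p (n : nat) c :=
  dense_below p [set q | exists2 r, c (n, r) & q <= r].

(* p ||- check n \notin c *)
Definition forces_notin p (n : nat) c :=
  forall q, q <= p -> ~ forces_in q n c.

(* p ||- check s is an initial segment of the characteristic function of c *)
Definition forces_initial p (s : seq bool) c :=
  forall i, (i < size s)%N ->
    if nth false s i then forces_in p i c else forces_notin p i c.

Definition dense_in_Cohen (D : set (seq bool)) :=
  forall s, exists2 t, prefix s t & D t.

(* p ||- for every dense subset D of 2^{<omega} lying in the ground model,
         some s \in check D is an initial segment of c *)
Definition forces_Cohen p c :=
  forall D, dense_in_Cohen D ->
    dense_below p [set q | exists2 s, D s & forces_initial q s c].

End Forcing.

Definition adds_Cohen_real (d : Order.disp_t) (P : porderType d) :=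
  exists c : set (nat * P), forall p : P, forces_Cohen p c.

Definition nonzero (d : Order.disp_t) (B : bPOrderType d) : Type :=
  {x : B | x != \bot}.

HB.instance Definition _ d (B : bPOrderType d) :=
  SubChoice.copy (nonzero B) {x : B | x != \bot}.
HB.instance Definition _ d (B : bPOrderType d) :=
  [SubChoice_isSubPOrder of nonzero B by <: with d].

Definition algebra_adds_Cohen_real (d : Order.disp_t)
    (B : ctbDistrLatticeType d) :=
  adds_Cohen_real (nonzero B).

Definition set_subalgebra {X : Type} (A : set (set X)) :=
  [/\ A set0, setC_closed A & setI_closed A].

Definition gen_subalgebra {X : Type} (G : set (set X)) : set (set X) :=
  smallest set_subalgebra G.

Section GenSubalgebra.
Context {X : Type} (G : set (set X)).
Local Notation A := (gen_subalgebra G).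

Lemma gen_subalgebra_set0 : A set0.
Proof. by move=> M [[]]. Qed.

Lemma gen_subalgebraC : setC_closed A.
Proof. by move=> S AS M [sM GM]; case: (sM) => _ + _; apply; exact: AS. Qed.

Lemma gen_subalgebraI : setI_closed A.
Proof.
move=> S T AS AT M [sM GM]; case: (sM) => _ _; apply.
  exact: AS.
exact: AT.
Qed.

Lemma gen_subalgebraU : setU_closed A.
Proof.
move=> S T AS AT.
have -> : S `|` T = ~` (~` S `&` ~` T) by rewrite setCI !setCK.
by apply: gen_subalgebraC; apply: gen_subalgebraI; exact: gen_subalgebraC.
Qed.

End GenSubalgebra.

Section QuotientByFin.
Context {X : Type} (G : set (set X)).

Definition subalgebra_type : Type := {S : set X | S \in gen_subalgebra G}.
HB.instance Definition _ :=
  SubChoice.copy subalgebra_type {S : set X | S \in gen_subalgebra G}.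

Implicit Types a b : subalgebra_type.

Definition sub0 : subalgebra_type :=
  exist _ set0 (mem_set (gen_subalgebra_set0 (G := G))).
Definition subC a : subalgebra_type :=
  exist _ (~` val a) (mem_set (gen_subalgebraC (set_mem (valP a)))).
Definition subI a b : subalgebra_type :=
  exist _ (val a `&` val b)
    (mem_set (gen_subalgebraI (set_mem (valP a)) (set_mem (valP b)))).
Definition subU a b : subalgebra_type :=
  exist _ (val a `|` val b)
    (mem_set (gen_subalgebraU (set_mem (valP a)) (set_mem (valP b)))).

(* `+` is the symmetric difference *)
Definition eq_mod_fin a b : bool := `[< finite_set (val a `+` val b) >].

Lemma eq_mod_fin_refl : reflexive eq_mod_fin.
Proof. by move=> a; apply/asboolP; rewrite setYK; exact: finite_set0. Qed.

Lemma eq_mod_fin_sym : symmetric eq_mod_fin.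
Proof. by move=> a b; rewrite /eq_mod_fin setYC. Qed.

Lemma eq_mod_fin_trans : transitive eq_mod_fin.
Proof.
move=> b a c /asboolP ab /asboolP bc; apply/asboolP.
apply: (@sub_finite_set _ _ ((val a `+` val b) `|` (val b `+` val c))).
  by move=> x; rewrite /setY /=; case: (pselect (val b x)); tauto.
by rewrite finite_setU.
Qed.

Canonical eq_mod_fin_equiv :=
  EquivRel eq_mod_fin eq_mod_fin_refl eq_mod_fin_sym eq_mod_fin_trans.

Definition mod_fin : Type := {eq_quot eq_mod_fin}.
HB.instance Definition _ := Choice.on mod_fin.
HB.instance Definition _ := Quotient.on mod_fin.
HB.instance Definition _ := EqQuotient.on mod_fin.

Implicit Types x y : mod_fin.

Definition qcompl x : mod_fin := \pi_mod_fin (subC (repr x)).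
Definition qmeet x y : mod_fin := \pi_mod_fin (subI (repr x) (repr y)).
Definition qjoin x y : mod_fin := \pi_mod_fin (subU (repr x) (repr y)).

Lemma pi_mod_finP a b :
  \pi_mod_fin a = \pi_mod_fin b <-> finite_set (val a `+` val b).
Proof.
split=> [ab|ab].
  have : a == b %[mod mod_fin] by apply/eqP.
  by rewrite eqmodE => /asboolP.
by apply/eqP; rewrite eqmodE; apply/asboolP.
Qed.

Lemma repr_piY a : finite_set (val (repr (\pi_mod_fin a)) `+` val a).
Proof. by apply/pi_mod_finP; rewrite reprK. Qed.

Lemma pi_compl a : qcompl (\pi_mod_fin a) = \pi_mod_fin (subC a).
Proof.
apply/pi_mod_finP => /=; apply: sub_finite_set (repr_piY a) => t.
by rewrite /setY /=; case: (pselect (val a t));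
  case: (pselect (val (repr (\pi_mod_fin a)) t)); tauto.
Qed.

Lemma pi_meet a b :
  qmeet (\pi_mod_fin a) (\pi_mod_fin b) = \pi_mod_fin (subI a b).
Proof.
apply/pi_mod_finP => /=.
apply: (@sub_finite_set _ _ ((val (repr (\pi_mod_fin a)) `+` val a) `|`
                             (val (repr (\pi_mod_fin b)) `+` val b))).
  move=> t; rewrite /setY /=.
  case: (pselect (val a t)); case: (pselect (val b t));
  case: (pselect (val (repr (\pi_mod_fin a)) t));
  by case: (pselect (val (repr (\pi_mod_fin b)) t)); tauto.
by rewrite finite_setU; split; exact: repr_piY.
Qed.

Lemma pi_join a b :
  qjoin (\pi_mod_fin a) (\pi_mod_fin b) = \pi_mod_fin (subU a b).
Proof.
apply/pi_mod_finP => /=.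
apply: (@sub_finite_set _ _ ((val (repr (\pi_mod_fin a)) `+` val a) `|`
                             (val (repr (\pi_mod_fin b)) `+` val b))).
  move=> t; rewrite /setY /=.
  case: (pselect (val a t)); case: (pselect (val b t));
  case: (pselect (val (repr (\pi_mod_fin a)) t));
  by case: (pselect (val (repr (\pi_mod_fin b)) t)); tauto.
by rewrite finite_setU; split; exact: repr_piY.
Qed.

Lemma qmeetC : commutative qmeet.
Proof.
elim/quotW=> a; elim/quotW=> b; rewrite !pi_meet.
by apply: (congr1 \pi_mod_fin); apply: val_inj; rewrite /= setIC.
Qed.

Lemma qjoinC : commutative qjoin.
Proof.
elim/quotW=> a; elim/quotW=> b; rewrite !pi_join.
by apply: (congr1 \pi_mod_fin); apply: val_inj; rewrite /= setUC.
Qed.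

Lemma qmeetA : associative qmeet.
Proof.
elim/quotW=> a; elim/quotW=> b; elim/quotW=> c.
rewrite (pi_meet b c) (pi_meet a b) (pi_meet a) (pi_meet _ c).
by apply: (congr1 \pi_mod_fin); apply: val_inj; rewrite /= setIA.
Qed.

Lemma qjoinA : associative qjoin.
Proof.
elim/quotW=> a; elim/quotW=> b; elim/quotW=> c.
rewrite (pi_join b c) (pi_join a b) (pi_join a) (pi_join _ c).
by apply: (congr1 \pi_mod_fin); apply: val_inj; rewrite /= setUA.
Qed.

Lemma qjoinKI y x : qmeet x (qjoin x y) = x.
Proof.
elim/quotW: x => a; elim/quotW: y => b; rewrite pi_join pi_meet.
by apply: (congr1 \pi_mod_fin); apply: val_inj; rewrite /= setUC setKU.
Qed.

Lemma qmeetKU y x : qjoin x (qmeet x y) = x.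
Proof.
elim/quotW: x => a; elim/quotW: y => b; rewrite pi_meet pi_join.
by apply: (congr1 \pi_mod_fin); apply: val_inj; rewrite /= setIC setKI.
Qed.

Lemma qmeetUl : left_distributive qmeet qjoin.
Proof.
elim/quotW=> a; elim/quotW=> b; elim/quotW=> c.
rewrite (pi_join a b) (pi_meet _ c) (pi_meet a c) (pi_meet b c) pi_join.
by apply: (congr1 \pi_mod_fin); apply: val_inj; rewrite /= setIUl.
Qed.

Lemma qmeetxx : idempotent_op qmeet.
Proof.
elim/quotW=> a; rewrite pi_meet.
by apply: (congr1 \pi_mod_fin); apply: val_inj; rewrite /= setIid.
Qed.

Fact mod_fin_display : Order.disp_t. Proof. exact: Order.Disp tt tt. Qed.

HB.instance Definition _ :=
  Order.isMeetJoinDistrLattice.Build mod_fin_display mod_fin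
    (fun x y => erefl (qmeet x y == x))
    (fun x y => erefl ((y != x) && (qmeet x y == x)))
    qmeetC qjoinC qmeetA qjoinA qjoinKI qmeetKU qmeetUl qmeetxx.

Definition qbot : mod_fin := \pi_mod_fin sub0.
Definition qtop : mod_fin := \pi_mod_fin (subC sub0).

Lemma qbot_le x : qbot <= x.
Proof.
apply/eqP; elim/quotW: x => a; rewrite pi_meet.
by apply: (congr1 \pi_mod_fin); apply: val_inj; rewrite /= set0I.
Qed.

Lemma qtop_ge x : x <= qtop.
Proof.
apply/eqP; elim/quotW: x => a; rewrite pi_meet.
by apply: (congr1 \pi_mod_fin); apply: val_inj; rewrite /= setC0 setIT.
Qed.

HB.instance Definition _ :=
  Order.hasBottom.Build mod_fin_display mod_fin qbot_le.
HB.instance Definition _ :=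
  Order.hasTop.Build mod_fin_display mod_fin qtop_ge.

Lemma qjoinxC x : qjoin x (qcompl x) = qtop.
Proof.
elim/quotW: x => a; rewrite pi_compl pi_join.
by apply: (congr1 \pi_mod_fin); apply: val_inj; rewrite /= setUv setC0.
Qed.

Lemma qmeetxC x : qmeet x (qcompl x) = qbot.
Proof.
elim/quotW: x => a; rewrite pi_compl pi_meet.
by apply: (congr1 \pi_mod_fin); apply: val_inj; rewrite /= setICr.
Qed.

HB.instance Definition _ :=
  Order.TBDistrLattice_hasComplement.Build mod_fin_display mod_fin
    qjoinxC qmeetxC.

Lemma mod_fin_eq0P a :
  \pi_mod_fin a = \bot :> mod_fin <-> finite_set (val a).
Proof.
have -> : val a = val a `+` val sub0 by rewrite setY0.
exact: pi_mod_finP.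
Qed.

Lemma mod_fin_leP a b :
  (\pi_mod_fin a : mod_fin) <= \pi_mod_fin b <->
  finite_set (val a `\` val b).
Proof.
have -> : ((\pi_mod_fin a : mod_fin) <= \pi_mod_fin b) =
          (\pi_mod_fin (subI a b) == \pi_mod_fin a) by rewrite -pi_meet.
have -> : val a `\` val b = val (subI a b) `+` val a.
  by apply/seteqP; split=> t; rewrite /setY /=;
    case: (pselect (val b t)); tauto.
by split=> [/eqP/pi_mod_finP //|H]; apply/eqP/pi_mod_finP.
Qed.

End QuotientByFin.

(* `I_n is the set of naturals below n; xsection S n is S(n) *)
Definition box (n : nat) : set (nat * nat) := `I_n `*` `I_(2 ^ n).

(* fset_set is empty on infinite sets, hence the finiteness clause *)
Definition slalom : set (set (nat * nat)) :=
  [set S | forall n, finite_set (xsection S n) /\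
                     (#|` fset_set (xsection S n)| < 2 ^ n)%N].

Definition small_slalom (R : realType) : set (set (nat * nat)) :=
  [set S | [/\ slalom S,
    forall n, xsection S n `<=` `I_(2 ^ n) &
    (fun n => #|` fset_set (xsection S n)|%:R / 2 ^+ n : R)%R
      @ \oo --> (0 : R)%R]].

Definition Omega_set : set (set (nat * nat) * nat) :=
  [set Sn | slalom Sn.1 /\ Sn.1 `<=` box Sn.2].

Definition Omega : Type := {Sn | Sn \in Omega_set}.

Definition T_slalom (A : set (nat * nat)) : set Omega :=
  [set t | A `&` box (val t).2 `<=` (val t).1].

Definition T_pair (s : Omega) : set Omega :=
  [set t | ((val s).2 <= (val t).2)%N /\
           (val t).1 `&` box (val s).2 = (val s).1].

Definition T_generators (V : set (set (nat * nat))) : set (set Omega) :=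
  [set T_slalom A | A in V] `|` range T_pair.

Definition T_mod_fin (V : set (set (nat * nat))) : Type :=
  mod_fin (T_generators V).
HB.instance Definition _ V :=
  Order.CTBDistrLattice.copy (T_mod_fin V) (mod_fin (T_generators V)).

(* Main.v *)
Require Import Defs.
From mathcomp Require Import all_boot all_order all_algebra.
From mathcomp Require Import finmap.
From mathcomp Require Import all_classical all_reals all_analysis.

Set Implicit Arguments.
Unset Strict Implicit.
Unset Printing Implicit Defensive.

Import Order.TTheory GRing.Theory Num.Theory.

Local Open Scope quotient_scope.
Local Open Scope classical_set_scope.

(** If (S, n) belongs to T_U and U(k) fills at most half of 2^k for k >= n, then
    T_(S,n) `&` T_U is infinite, and such sets are dense below every infinite
    member of the algebra.  Such a set fixes the traces S(k) of the generic
    slalom on 2^k for k < n, while for k >= n this trace may still be taken to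
    be U(k) or U(k) plus one point, so its parity is free.  Hence the sequence of
    these parities is Cohen. *)

(** Cutting column k at 2^k makes the parity a function of the trace of S on any [box n] with k < n,
    which is what [T_pair] records. *)
Definition bit (S : set (nat * nat)) (k : nat) : bool :=
  odd #|` fset_set (xsection S k `&` `I_(2 ^ k))|.

(** Division-free form of the density bound |U(k)|/2^k <= 1/c, asked only from column n on; the
    earlier columns are taken care of by requiring [T_slalom U t] at level at least n. *)
Definition slim (c n : nat) (U : set (nat * nat)) :=
  forall k, xsection U k `<=` `I_(2 ^ k) /\
    (n <= k -> c * #|` fset_set (xsection U k)| <= 2 ^ k).

Definition cond (t : Omega) (U : set (nat * nat)) : set Omega :=
  T_pair t `&` T_slalom U.

(** * Levels in Omega and finiteness *)

Lemma finite_subsets (T : choiceType) (D : set T) :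
  finite_set D -> finite_set [set A | A `<=` D].
Proof.
move=> fD; apply: (@sub_finite_set _ _
  ((fun F : {fset T} => [set` F]) @` [set` fpowerset (fset_set D)])).
  move=> A AD; have fA := sub_finite_set AD fD.
  exists (fset_set A); last by rewrite fset_setK.
  by rewrite /= fpowersetE -fset_set_sub.
exact: finite_image.
Qed.

Lemma sub_box m n : m <= n -> box m `<=` box n.
Proof.
move=> mn [i j] [/= im jm]; split=> /=; first exact: leq_trans mn.
by apply: leq_trans jm _; rewrite leq_pexp2l.
Qed.

Lemma finite_box n : finite_set (box n).
Proof. exact: finite_setX. Qed.

Lemma Omega_slalom (t : Omega) : slalom (val t).1.
Proof. by have /set_mem[] := valP t. Qed.

Lemma Omega_box (t : Omega) : (val t).1 `<=` box (val t).2.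
Proof. by have /set_mem[] := valP t. Qed.

(** Such a member is a subset of the finite [box n] together with a number below n. *)
Lemma finite_Omega_below n : finite_set [set t : Omega | (val t).2 < n].
Proof.
apply: (@sub_finite_set _ _
    ((val : Omega -> _) @^-1` ([set A | A `<=` box n] `*` `I_n))).
  move=> t tn; split=> //=.
  by apply: subset_trans (@Omega_box t) _; apply: sub_box; exact: ltnW.
apply: finite_preimage; first by move=> x y _ _; exact: val_inj.
by apply: finite_setX => //; apply: finite_subsets; exact: finite_box.
Qed.

(** With its converse below, this translates being nonzero modulo Fin into having members of
    arbitrarily high level. *)
Lemma infinite_level (b : set Omega) n :
  infinite_set b -> exists2 t, b t & n <= (val t).2.
Proof.
move=> ib; apply: contrapT => nt; apply: ib.
apply: sub_finite_set (finite_Omega_below n) => t bt /=.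
by rewrite ltnNge; apply/negP => tn; apply: nt; exists t.
Qed.

Lemma level_infinite (b : set Omega) :
  (forall n, exists2 t, b t & n <= (val t).2) -> infinite_set b.
Proof.
move=> lb fb.
have fi : finite_set [set (val t).2 | t in b] by exact: finite_image.
(* The level asked for is one more than the largest level occurring in b. *)
have [t bt] := lb (\max_(i <- fset_set [set (val t).2 | t in b]) i).+1.
apply/negP; rewrite -ltnNge ltnS; apply: leq_bigmax_seq => //.
by rewrite in_fset_set// inE; exists t.
Qed.

(** * Column sets of small density *)

Lemma slim_finite c n U k : slim c n U -> finite_set (xsection U k).
Proof. by move=> /(_ k)[Uk _]; exact: sub_finite_set Uk (finite_II _). Qed.

Lemma slim_leq c m n U : m <= n -> slim c m U -> slim c n U.
Proof.
move=> mn sU k; have [Uk cU] := sU k; split=> // nk.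
by apply: cU; exact: leq_trans nk.
Qed.

Lemma slimU c n U1 U2 :
  slim (2 * c) n U1 -> slim (2 * c) n U2 -> slim c n (U1 `|` U2).
Proof.
move=> s1 s2 k; have [U1k c1] := s1 k; have [U2k c2] := s2 k.
have -> : xsection (U1 `|` U2) k = xsection U1 k `|` xsection U2 k.
  by apply/seteqP; split=> j; rewrite /xsection /= !inE.
split=> [j [/U1k|/U2k]//|nk].
rewrite fset_setU; [|exact: slim_finite s1|exact: slim_finite s2].
(* After doubling both sides, the two bounds with ratio 2c add up. *)
rewrite -(@leq_pmul2l 2)// mulnA.
apply: (@leq_trans (2 * c * (#|` fset_set (xsection U1 k)| +
                             #|` fset_set (xsection U2 k)|))).
  by rewrite leq_mul2l -cardfsUI leq_addr orbT.
by rewrite mulnDr [leqRHS]mul2n -addnn; apply: leq_add; [exact: c1|exact: c2].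
Qed.

Lemma slim0 c n : slim c n set0.
Proof. by move=> k; rewrite xsection0 fset_set0 cardfs0 muln0; split. Qed.

Lemma small_slalom_slim (R : realType) A c :
  small_slalom R A -> exists n, slim c n A.
Proof.
move=> [_ Ak /cvgr0Pnorm_lt A0].
(* The threshold 1/(c+1) is positive even for c = 0 and lies below 1/c otherwise. *)
have c0 : (0 < (c.+1%:R)^-1 :> R)%R by rewrite invr_gt0 ltr0n.
have [n _ nA] := A0 _ c0; exists n => k; split=> // nk.
have := nA _ nk; rewrite /= ger0_norm ?divr_ge0 ?exprn_ge0//.
rewrite ltr_pdivrMr ?exprn_gt0// mulrC ltr_pdivlMr ?ltr0n//.
rewrite -natrX -natrM ltr_nat => H.
apply: ltnW; apply: leq_ltn_trans H; rewrite mulnC.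
by rewrite leq_mul2l leqnSn orbT.
Qed.

(** * The sets [cond t U] and extensions with prescribed parities *)

Lemma T_slalomU U1 U2 : T_slalom (U1 `|` U2) = T_slalom U1 `&` T_slalom U2.
Proof.
by apply/seteqP; split=> t; rewrite /T_slalom /= setIUl subUset.
Qed.

Lemma T_slalom0 : T_slalom set0 = setT.
Proof. by apply/seteqP; split=> t //= _; rewrite /T_slalom /= set0I. Qed.

Lemma T_pair_refl t : T_pair t t.
Proof. by split=> //; apply/setIidPl; exact: Omega_box. Qed.

Lemma T_pair_sub t t' : T_pair t t' -> T_pair t' `<=` T_pair t.
Proof.
move=> [tt' tE] t2 [t't2 t'E]; split; first exact: leq_trans t't2.
rewrite -tE -t'E -setIA; congr (_ `&` _).
by apply/esym/setIidPr; exact: sub_box.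
Qed.

Lemma cond_refl t U : T_slalom U t -> cond t U t.
Proof. by split => //; exact: T_pair_refl. Qed.

Lemma cond_sub t t' U : cond t U t' -> cond t' U `<=` cond t U.
Proof. by move=> [/T_pair_sub tt' _] t2 [/tt']. Qed.

Lemma T_pair_bit t t' k : T_pair t t' -> k < (val t).2 ->
  bit (val t').1 k = bit (val t).1 k.
Proof.
move=> [tt' <-] kt; rewrite /bit; congr (odd #|` fset_set _|).
apply/seteqP; split=> j; rewrite /xsection /= !inE.
  move=> [t'j jk]; split=> //; split=> //; split=> //=.
  by apply: leq_trans jk _; rewrite leq_pexp2l// ltnW.
by move=> [[]].
Qed.

(** Keep t below its level m, and let column k for m <= k < M be U(k), plus one spare point when its
    parity differs from f(k). *)
Lemma cond_extend t U f M :
  2 <= (val t).2 -> slim 2 (val t).2 U -> T_slalom U t -> (val t).2 <= M ->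
  exists t', [/\ cond t U t', (val t').2 = M &
    forall k, (val t).2 <= k < M -> bit (val t').1 k = f k].
Proof.
set m := (val t).2 => m2 sU tU mM.
have finU k := slim_finite k sU.
have Uk k : xsection U k `<=` `I_(2 ^ k) by case: (sU k).
(* Since k >= 2, both |U(k)| and 2 are at most 2^(k-1). So U(k) misses a point, and adding it still
   leaves fewer than 2^k points, as a slalom requires. *)
have room k : m <= k -> #|` fset_set (xsection U k)|.+1 < 2 ^ k.
  move=> mk; have [_ /(_ mk)] := sU k.
  have k2 : 2 <= k by exact: leq_trans mk.
  case: k k2 {mk} => // k k2; rewrite expnS leq_pmul2l// => Uk1.
  have k1 : 2 <= 2 ^ k by rewrite -[leqLHS]expn1 leq_pexp2l.
  by rewrite mul2n -addnn -addn2; exact: leq_add.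
have [x xU] : {x : nat -> nat & forall k, m <= k ->
    x k < 2 ^ k /\ ~ xsection U k (x k)}.
  apply: (@choice _ _ (fun k j => m <= k -> j < 2 ^ k /\ ~ xsection U k j)).
  move=> k; apply: contrapT => nx.
  (* Below m the requirement on the spare point is vacuous, and 0 is a default value. *)
  have mk : m <= k by apply: contrapT => mk; apply: nx; exists 0.
  have : `I_(2 ^ k) `<=` xsection U k.
    move=> j jk; apply: contrapT => nj; apply: nx; exists j => _; split=> //.
  move=> sub; have := room _ mk.
  have -> : xsection U k = `I_(2 ^ k) by apply/seteqP.
  by rewrite (card_fset_set (card_eqxx _)) ltnNge leqnSn.
pose col k := xsection U k `|`
   [set j | j = x k /\ odd #|` fset_set (xsection U k)| != f k].
pose S := (val t).1 `|` [set kj | m <= kj.1 < M /\ col kj.1 kj.2].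
have Slow k : k < m -> xsection S k = xsection (val t).1 k.
  move=> km; apply/seteqP; split=> j; rewrite /xsection /= !inE; last by left.
  by case=> //= -[/andP[]]; rewrite leqNgt km.
have Shigh k : m <= k < M -> xsection S k = col k.
  move=> km; apply/seteqP; split=> j; rewrite /xsection /= !inE.
    case=> /=; last by case.
    move=> /Omega_box[/=]; rewrite ltnNge -/m.
    by case/andP: km => ->.
  by right.
have Sout k : M <= k -> xsection S k = set0.
  move=> Mk; apply/seteqP; split=> j; rewrite /xsection /= ?inE//.
  case=> /=.
    move=> /Omega_box[/=]; rewrite ltnNge -/m.
    by rewrite (leq_trans mM Mk).
  by case=> /andP[_]; rewrite ltnNge Mk.
have colk k : m <= k -> col k `<=` `I_(2 ^ k).
  by move=> mk j [/Uk//|/= [-> _]]; case: (xU _ mk).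
have cardcol k : m <= k -> #|` fset_set (col k)| =
    #|` fset_set (xsection U k)| + (odd #|` fset_set (xsection U k)| != f k).
  move=> mk; case: (boolP (_ != _)) => /= h.
    have -> : col k = x k |` xsection U k.
      by apply/seteqP; split=> j; rewrite /col /= h;
        [case=> [?|[]]; [right|left]|case=> [->|?]; [right|left]].
    rewrite fset_setU1// cardfsU1 in_fset_set// addnC.
    by rewrite memNset//; case: (xU _ mk).
  have -> : col k = xsection U k.
    by apply/seteqP; split=> j; rewrite /col /= ?(negbTE h);
      [case=> [|[]]|left].
  by rewrite addn0.
have OS : (S, M) \in Omega_set.
  apply/mem_set; split=> /=.
    move=> k; have [km|mk] := ltnP k m.
      by rewrite Slow//; exact: Omega_slalom.
    have [kM|Mk] := ltnP k M; last first.
      by rewrite Sout// fset_set0 cardfs0 expn_gt0.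
    rewrite Shigh ?mk//; split.
      by apply: sub_finite_set (colk _ mk) _.
    rewrite cardcol//; apply: leq_ltn_trans (room _ mk).
    by rewrite -addn1 leq_add2l; case: (_ != _).
  move=> [k j] /= [/Omega_box|[/= /andP[mk kM] /(colk _ mk) /= jk]].
    exact: sub_box.
  by split=> //=; apply: leq_trans jk _; rewrite leq_pexp2l// ltnW.
exists (exist _ (S, M) OS); split=> //=; last first.
  move=> k /[dup] km /andP[mk kM]; rewrite /bit Shigh//.
  have -> : col k `&` `I_(2 ^ k) = col k by apply/setIidPl; exact: colk.
  rewrite cardcol// oddD.
  by case: (odd _) (f k) => [] [].
split.
  split=> //=; apply/seteqP; split=> [[k j] /= [[//|/= [/andP[mk _] _]]]|].
    by case=> /=; rewrite -/m ltnNge mk.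
  by move=> kj tkj; split; [left|exact: Omega_box].
move=> [k j] /= [Ukj [/= kM jM]].
(* Below m, U is covered because t lies in T_U; from m on, because [col k] contains U(k). *)
have [km|mk] := ltnP k m; [left|right].
  apply: tU; split=> //; split=> //=.
  have /= := Uk k j; rewrite /xsection /= inE => /(_ Ukj) jk.
  by apply: leq_trans jk _; rewrite leq_pexp2l// ltnW.
by split=> /=; [rewrite mk|left; rewrite /xsection /= inE].
Qed.

(** Extensions with arbitrary parities reach every level above that of t. *)
Lemma cond_infinite t U :
  2 <= (val t).2 -> slim 2 (val t).2 U -> T_slalom U t ->
  infinite_set (cond t U).
Proof.
move=> t2 sU tU; apply: level_infinite => n.
have [t' [tt' t'n _]] :=
  cond_extend xpredT t2 sU tU (leq_maxl (val t).2 n).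
by exists t' => //; rewrite t'n leq_maxr.
Qed.

(** * The generated algebra: a dense family of conditions and the name of the Cohen real *)

Section Algebra.
Variable R : realType.
Local Notation G := (T_generators (small_slalom R)).
Local Notation B := (T_mod_fin (small_slalom R)).

(** As t itself lies in [cond t U], the alternative that holds is the one that t satisfies. The
    first clause puts [cond t U] in the algebra. *)
Definition decides (b : set Omega) t U :=
  [/\ gen_subalgebra G (T_slalom U), T_slalom U t &
      cond t U `<=` b \/ cond t U `<=` ~` b].

(* The bound n must not depend on t: otherwise the column sets U provided for an
   infinite b could be too large between the level of t and n.  Quantifying over
   every ratio c makes the property stable under intersections, which double
   U(k). *)
Definition uniformly_decided (b : set Omega) := forall c, exists n,
  forall t : Omega, n <= (val t).2 -> exists2 U, slim c n U & decides b t U.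

Lemma gen_subalgebra_T_slalom0 : gen_subalgebra G (T_slalom set0).
Proof.
rewrite T_slalom0 -setC0; apply: gen_subalgebraC; exact: gen_subalgebra_set0.
Qed.

Lemma gen_subalgebra_decided : gen_subalgebra G `<=` uniformly_decided.
Proof.
apply: smallest_sub.
  split.
  - move=> c; exists 0 => t _; exists set0; first exact: slim0.
    split; [exact: gen_subalgebra_T_slalom0|by rewrite T_slalom0|].
    by right; rewrite setC0.
  - move=> b db c; have [n nb] := db c; exists n => t /nb[U sU [GU tU bU]].
    by exists U => //; split => //; rewrite setCK; tauto.
  - move=> b1 b2 d1 d2 c.
    have [n1 nb1] := d1 (2 * c); have [n2 nb2] := d2 (2 * c).
    exists (maxn n1 n2) => t; rewrite geq_max => /andP[/nb1 + /nb2].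
    move=> [U1 sU1 [GU1 tU1 bU1]] [U2 sU2 [GU2 tU2 bU2]].
    exists (U1 `|` U2).
      by apply: slimU; [apply: slim_leq sU1; exact: leq_maxl|
                        apply: slim_leq sU2; exact: leq_maxr].
    rewrite /decides /cond T_slalomU; split; first exact: gen_subalgebraI.
      by split.
    case: bU1 => bU1; last by right=> s [ts [s1 s2]] [b1s _]; exact: (bU1 s).
    case: bU2 => bU2; last by right=> s [ts [s1 s2]] [_ b2s]; exact: (bU2 s).
    by left=> s [ts [s1 s2]]; split; [exact: bU1|exact: bU2].
move=> _ [[A VA <-]|[s _ <-]] c.
  have [n sA] := small_slalom_slim c VA; exists n => t _.
  (* If t lies in T_A, then U = A decides positively; its density tends to 0, so it is slim from an
     n independent of t. *)
  have [tA|ntA] := pselect (T_slalom A t).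
    exists A => //; split=> //; last by left=> ? [].
    by apply: sub_gen_smallest; left; exists A.
  exists set0; first exact: slim0.
  split; [exact: gen_subalgebra_T_slalom0|by rewrite T_slalom0|].
  (* A point of A in the box of t that t omits is omitted by every extension of t. *)
  right=> s [[ts tE] _] sA'; apply: ntA => kj [Akj bkj].
  by rewrite -tE; split=> //; apply: sA'; split=> //; exact: sub_box bkj.
(* From the level of s on, the trace of t on the box of s settles whether extensions of t extend
   s. *)
exists (val s).2 => t st; exists set0; first exact: slim0.
split; [exact: gen_subalgebra_T_slalom0|by rewrite T_slalom0|].
have [sPt|nsPt] := pselect (T_pair s t).
  by left=> t' [+ _]; exact: T_pair_sub.
right=> t' [[tt' tE] _] [st' sE]; apply: nsPt; split=> //.
rewrite -tE -setIA -sE; congr (_ `&` _).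
by apply/setIidPr; exact: sub_box.
Qed.

Lemma gen_subalgebra_cond t U :
  gen_subalgebra G (T_slalom U) -> gen_subalgebra G (cond t U).
Proof.
move=> GU; apply: gen_subalgebraI => //.
by apply: sub_gen_smallest; right; exists t.
Qed.

Lemma cond_dense b : gen_subalgebra G b -> infinite_set b ->
  exists t U, [/\ 2 <= (val t).2, slim 2 (val t).2 U,
    gen_subalgebra G (T_slalom U), T_slalom U t & cond t U `<=` b].
Proof.
move=> Gb ib; have [n nb] := gen_subalgebra_decided Gb 2.
(* Level 2 gives the room needed by [cond_extend], level n the decision; membership of t in b then
   excludes the negative one. *)
have [t bt] := infinite_level (maxn 2 n) ib.
rewrite geq_max => /andP[t2 nt]; have [U sU [GU tU bU]] := nb _ nt.
exists t, U; split=> //; first exact: slim_leq sU.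
by case: bU => // /(_ _ (cond_refl tU)).
Qed.

(** Names the set of k at which the generic slalom has an odd trace. Asking only for some
    representative makes the clause depend on the class modulo Fin. *)
Definition parity_name : set (nat * nonzero B) :=
  [set nr | exists2 a : subalgebra_type G, val nr.2 = \pi_(mod_fin G) a &
    forall t, val a t -> bit (val t).1 nr.1].

Lemma nonzero_repr (q : nonzero B) : exists2 a : subalgebra_type G,
  val q = \pi_(mod_fin G) a & infinite_set (val a).
Proof.
case: q => q q0 /=; exists (repr (q : mod_fin G)); first by rewrite reprK.
move=> /mod_fin_eq0P; rewrite reprK => qE.
by move: q0; rewrite -qE eqxx.
Qed.

Lemma cond_nonzero t U :
  gen_subalgebra G (T_slalom U) -> infinite_set (cond t U) ->
  exists (r : nonzero B) (a : subalgebra_type G),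
    val r = \pi_(mod_fin G) a /\ val a = cond t U.
Proof.
move=> GU icond.
pose a : subalgebra_type G :=
  exist _ (cond t U) (mem_set (gen_subalgebra_cond t GU)).
have a0 : (\pi_(mod_fin G) a : B) != Order.bottom.
  by apply/eqP => /mod_fin_eq0P.
by exists (exist _ (\pi_(mod_fin G) a : B) a0), a.
Qed.

Lemma nonzero_leP (q r : nonzero B) (a b : subalgebra_type G) :
  val q = \pi_(mod_fin G) a -> val r = \pi_(mod_fin G) b ->
  (q <= r)%O <-> finite_set (val a `\` val b).
Proof. by move=> qa rb; rewrite -mod_fin_leP -qa -rb. Qed.

Lemma parity_name_Cohen p : forces_Cohen p parity_name.
Proof.
move=> D dD q _.
have [b qb ib] := nonzero_repr q.
have [t [U [t2 sU GU tU Ub]]] := cond_dense (set_mem (valP b)) ib.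
(* The parities fixed by t are extended to a string s in D; t is then extended to level [size s] so
   that its parities spell s. *)
have [s pre Ds] := dD (mkseq (bit (val t).1) (val t).2).
have ts : (val t).2 <= size s by have := size_prefix pre; rewrite size_mkseq.
have [t' [tt' t's bits]] := cond_extend (nth false s) t2 sU tU ts.
have {}bits k : k < size s -> bit (val t').1 k = nth false s k.
  move=> ks; have [kt|tk] := ltnP k (val t).2; last by apply: bits; rewrite tk.
  case: tt' => [tt' _]; rewrite (T_pair_bit tt' kt).
  move: pre => /prefixP[s' ->]; rewrite nth_cat size_mkseq kt nth_mkseq//.
have icond : infinite_set (cond t' U).
  apply: cond_infinite; last by case: tt'.
    by rewrite t's; exact: leq_trans ts.
  by apply: slim_leq sU; rewrite t's.
have [r [a [ra aE]]] := cond_nonzero GU icond.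
exists r.
  apply/(nonzero_leP ra qb); rewrite aE.
  have : cond t' U `<=` val b by move=> x /(cond_sub tt')/Ub.
  by rewrite -setD_eq0 => ->; exact: finite_set0.
exists s => // k ks; have kt' : k < (val t').2 by rewrite t's.
have abit x : val a x -> bit (val x).1 k = nth false s k.
  by rewrite aE => -[/T_pair_bit -> // _]; exact: bits.
case: (boolP (nth false s k)) => sk.
  (* The condition r is itself paired with k in the name. *)
  move=> q' q'r; exists q'; first exact: lexx.
  by exists r => //; exists a => // x /abit ->.
(* A representative of r' would be contained modulo Fin both in a, where the k-th parity is even,
   and in a'', where it is odd, hence be finite. *)
move=> q' q'r /(_ q' (lexx _))[r' r'q' [r'' [a'' r''a'' a''bit] r'r'']].
have [e r'e ie] := nonzero_repr r'.
apply: ie; apply: (@sub_finite_set _ _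
  ((val e `\` val a) `|` (val e `\` val a''))).
  move=> x ex; have [ax|] := pselect (val a x); last by left.
  by right; split=> // /a''bit; rewrite /= (abit _ ax); exact/negP.
rewrite finite_setU; split; first exact/(nonzero_leP r'e ra)/(le_trans r'q').
exact/(nonzero_leP r'e r''a'').
Qed.

End Algebra.

Theorem theorem5p23 (R : realType) :
  algebra_adds_Cohen_real (T_mod_fin (small_slalom R)).
Proof. by exists (@parity_name R) => p; exact: parity_name_Cohen. Qed.
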